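(* Let $K$ be a field of characteristic zero, let $n \ge 1$, let $\mathfrak{m} = (x_1,\dots,x_n) \subseteq K[x_1,\dots,x_n]$, $R = K[x_1,\dots,x_n]/\mathfrak{m}^2$ and $V = \mathfrak{m}/\mathfrak{m}^2$, so that $R = K \oplus V$ as a $K$-vector space. A $K$-linear map $P : R \to R$ is a Rota--Baxter operator of weight one if and only if there exist $\alpha \in \{0,-1\}$ and an idempotent $Q \in \operatorname{End}_K(V)$ (i.e. $Q^2 = Q$) such that $$P(a+u) = \alpha a - Q(u) \qquad \text{for all } a \in K,\ u \in V.$$
   Context: A $K$-linear map $P : R \to R$ is a Rota--Baxter operator of weight one if $P(x)P(y) = P\bigl(xP(y) + P(x)y + xy\bigr)$ for all $x,y \in R$. In the decomposition $R = K \oplus V$, $K$ is identified with the scalar multiples of the unit $1$, and $V$ is the $n$-dimensional space with basis the images $\bar x_1,\dots,\bar x_n$ of $x_1,\dots,x_n$. Multiplication is $(a+u)(b+v) = ab + av + bu$ for $a,b\in K$, $u,v\in V$, so $V\cdot V = 0$. $\operatorname{End}_K(V)$ is the algebra of $K$-linear endomorphisms of $V$. *)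

(* Defs.v *)
From HB Require Import structures.
From mathcomp Require Import all_boot all_order all_algebra.
From mathcomp Require Import boolp.
From mathcomp Require Import mpoly.

Set Implicit Arguments.
Unset Strict Implicit.
Unset Printing Implicit Defensive.

Import GRing.Theory.
Local Open Scope ring_scope.
Local Open Scope quotient_scope.

(* The quotient {ideal_quot I} of ring_quotient needs a boolean predicate I,
   hence the classical reflection `[< _ >] of the existential definitions. *)
Section Ideals.
Variable A : comNzRingType.

Definition ideal_span (I : finType) (g : I -> A) : {pred A} :=
  fun p => `[< exists c : I -> A, p = \sum_i c i * g i >].

Definition ideal_prod (I J : {pred A}) : {pred A} :=
  fun p => `[< exists s : seq (A * A),
    (forall u, u \in s -> u.1 \in I /\ u.2 \in J)
    /\ p = \sum_(u <- s) u.1 * u.2 >].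

End Ideals.

Section FirstOrderRing.
Variables (n : nat) (K : fieldType).

Definition max_ideal : {pred {mpoly K[n]}} :=
  ideal_span (fun i : 'I_n => 'X_i : {mpoly K[n]}).

Definition max_ideal_sq : {pred {mpoly K[n]}} :=
  ideal_prod max_ideal max_ideal.

Lemma max_idealP p :
  reflect (exists c : 'I_n -> {mpoly K[n]}, p = \sum_i c i * 'X_i)
          (p \in max_ideal).
Proof. exact: asboolP. Qed.

Lemma max_ideal_sqP p :
  reflect (exists s : seq ({mpoly K[n]} * {mpoly K[n]}),
             (forall u, u \in s -> u.1 \in max_ideal /\ u.2 \in max_ideal)
             /\ p = \sum_(u <- s) u.1 * u.2)
          (p \in max_ideal_sq).
Proof. exact: asboolP. Qed.

Lemma max_ideal0 : 0 \in max_ideal.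
Proof.
by apply/max_idealP; exists (fun=> 0); rewrite big1 // => i _; rewrite mul0r.
Qed.

Lemma max_idealD p q :
  p \in max_ideal -> q \in max_ideal -> p + q \in max_ideal.
Proof.
move=> /max_idealP[c ->] /max_idealP[d ->]; apply/max_idealP.
exists (fun i => c i + d i); rewrite -big_split /=.
by apply: eq_bigr => i _; rewrite mulrDl.
Qed.

Lemma max_idealMl a p : p \in max_ideal -> a * p \in max_ideal.
Proof.
move=> /max_idealP[c ->]; apply/max_idealP.
exists (fun i => a * c i); rewrite mulr_sumr.
by apply: eq_bigr => i _; rewrite mulrA.
Qed.

Lemma max_ideal_meval0 p : p \in max_ideal -> p.@[fun=> 0] = 0.
Proof.
move=> /max_idealP[c ->]; rewrite raddf_sum big1 //= => i _.
by rewrite mevalM mevalXU mulr0.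
Qed.

Lemma max_ideal_sq_closed : idealr_closed max_ideal_sq.
Proof.
split.
- by apply/max_ideal_sqP; exists [::]; split=> //; rewrite big_nil.
- apply/negP => /max_ideal_sqP[s [sm /(congr1 (meval (fun=> 0)))]].
  rewrite meval1 raddf_sum big_seq big1 => [/eqP|u /sm[u1 _]].
    by rewrite oner_eq0.
  by rewrite /= mevalM max_ideal_meval0 // mul0r.
- move=> a p q /max_ideal_sqP[s [sm ->]] /max_ideal_sqP[t [tm ->]].
  apply/max_ideal_sqP; exists ([seq (a * u.1, u.2) | u <- s] ++ t); split.
    move=> u; rewrite mem_cat => /orP[/mapP[v vs ->] /=|/tm //].
    by have [v1 v2] := sm v vs; split=> //; apply: max_idealMl.
  rewrite big_cat big_map mulr_sumr; congr (_ + _).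
  by apply: eq_bigr => u _; rewrite mulrA.
Qed.

HB.instance Definition _ :=
  isIdealr.Build {mpoly K[n]} max_ideal_sq max_ideal_sq_closed.

Definition quot_ring : Type := {ideal_quot max_ideal_sq}.

HB.instance Definition _ := GRing.ComNzRing.on quot_ring.

Definition quot_proj (p : {mpoly K[n]}) : quot_ring :=
  \pi_{ideal_quot max_ideal_sq} p.

Lemma quot_proj_is_zmod_morphism : zmod_morphism quot_proj.
Proof. exact: pi_is_zmod_morphism. Qed.

Lemma quot_proj_is_monoid_morphism : monoid_morphism quot_proj.
Proof. exact: pi_is_monoid_morphism. Qed.

HB.instance Definition _ := GRing.isZmodMorphism.Build
  {mpoly K[n]} quot_ring quot_proj quot_proj_is_zmod_morphism.
HB.instance Definition _ := GRing.isMonoidMorphism.Build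
  {mpoly K[n]} quot_ring quot_proj quot_proj_is_monoid_morphism.

Lemma quot_projP x : exists p, quot_proj p = x.
Proof. by exists (repr (x : {ideal_quot max_ideal_sq})); exact: reprK. Qed.

Lemma quot_proj_eq0 p : (quot_proj p == 0) = (p \in max_ideal_sq).
Proof.
rewrite -(rmorph0 quot_proj) -[in RHS](subr0 p).
by rewrite (Quotient.idealrBE max_ideal_sq).
Qed.

Definition quot_scale (a : K) (x : quot_ring) : quot_ring :=
  quot_proj a%:MP * x.

Lemma quot_scaleA a b x :
  quot_scale a (quot_scale b x) = quot_scale (a * b) x.
Proof. by rewrite /quot_scale mulrA -rmorphM -mpolyCM. Qed.

Lemma quot_scale1 : left_id 1 quot_scale.
Proof. by move=> x; rewrite /quot_scale rmorph1 mul1r. Qed.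

Lemma quot_scaleDr : right_distributive quot_scale +%R.
Proof. by move=> a x y; rewrite /quot_scale mulrDr. Qed.

Lemma quot_scaleDl x : {morph quot_scale^~ x : a b / a + b}.
Proof. by move=> a b; rewrite /quot_scale mpolyCD rmorphD mulrDl. Qed.

HB.instance Definition _ := GRing.Zmodule_isLmodule.Build
  K quot_ring quot_scaleA quot_scale1 quot_scaleDr quot_scaleDl.

Lemma quot_scaleAl (a : K) (x y : quot_ring) : a *: (x * y) = a *: x * y.
Proof. exact: mulrA. Qed.

HB.instance Definition _ :=
  GRing.Lmodule_isLalgebra.Build K quot_ring quot_scaleAl.
HB.instance Definition _ := GRing.Lalgebra_isComAlgebra.Build K quot_ring.

Lemma quot_projZ (a : K) p : quot_proj (a *: p) = a *: quot_proj p.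
Proof. by rewrite -mul_mpolyC rmorphM. Qed.

(* m / m^2 is realised as the image of m in R = K[x_1, ..., x_n] / m^2, so that
   the inclusion V -> R is val; quot_ring_direct_sum below is R = K (+) V. *)
Definition cotangent : {pred quot_ring} :=
  fun x => `[< exists2 p, p \in max_ideal & x = quot_proj p >].

Lemma cotangentP x :
  reflect (exists2 p, p \in max_ideal & x = quot_proj p) (x \in cotangent).
Proof. exact: asboolP. Qed.

Lemma cotangent_submod_closed : submod_closed cotangent.
Proof.
split; first by apply/cotangentP; exists 0; rewrite ?max_ideal0 ?rmorph0.
move=> a x y /cotangentP[p pm ->] /cotangentP[q qm ->]; apply/cotangentP.
exists (a *: p + q); last by rewrite rmorphD /= quot_projZ.
by apply: max_idealD => //; rewrite -mul_mpolyC; apply: max_idealMl.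
Qed.

HB.instance Definition _ :=
  GRing.isSubmodClosed.Build K quot_ring cotangent cotangent_submod_closed.

Definition cotangent_space : Type := {x : quot_ring | x \in cotangent}.

HB.instance Definition _ := SubChoice.on cotangent_space.
HB.instance Definition _ :=
  [SubChoice_isSubLmodule of cotangent_space by <:].

Lemma max_ideal_X i : 'X_i \in max_ideal.
Proof.
apply/max_idealP; exists (fun j => (j == i)%:R).
rewrite (bigD1 i) //= eqxx mul1r big1 ?addr0 // => j /negPf->.
by rewrite mul0r.
Qed.

Lemma max_ideal_sub_meval0 p : p - (p.@[fun=> 0])%:MP \in max_ideal.
Proof.
elim/mpolyind: p => [|c m p _ _ IHp].
  by rewrite meval0 mpolyC0 subr0 max_ideal0.
rewrite mevalD mpolyCD opprD addrACA; apply: max_idealD => //.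
rewrite mevalZ mevalX.
have [/existsP[i mi]|] := boolP [exists i, m i != 0%N]; last first.
  rewrite negb_exists => /forallP m0.
  have {m0}-> : m = 0%MM.
    by apply/mnmP => i; rewrite mnmE; apply/eqP; rewrite -[_ == _]negbK m0.
  rewrite mpolyX0 big1 => [|i _]; last by rewrite mnmE expr0.
  by rewrite mulr1 alg_mpolyC subrr max_ideal0.
rewrite (bigD1 i) //= expr0n (negPf mi) mul0r mulr0 mpolyC0 subr0.
have /submK <- : (U_(i) <= m)%MM by rewrite lep1mP.
rewrite mpolyXD -mul_mpolyC mulrA.
exact/max_idealMl/max_ideal_X.
Qed.

Lemma quot_ring_alg (a : K) : a%:A = quot_proj a%:MP.
Proof. by rewrite -alg_mpolyC quot_projZ rmorph1. Qed.

Lemma quot_ring_direct_sum (x : quot_ring) :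
  exists! au : K * cotangent_space, x = au.1%:A + val au.2.
Proof.
have [p <-] := quot_projP x.
have Vp : quot_proj (p - (p.@[fun=> 0])%:MP) \in cotangent.
  apply/cotangentP; exists (p - (p.@[fun=> 0])%:MP) => //.
  exact: max_ideal_sub_meval0.
exists (p.@[fun=> 0], exist (fun x => x \in cotangent) _ Vp); split.
  by rewrite /= quot_ring_alg rmorphB /= addrC subrK.
move=> [a [y Vy]] /=; rewrite quot_ring_alg => Dp.
have [q qm Dy] := cotangentP _ Vy.
have Da : p.@[fun=> 0] = a.
  move: Dp => /eqP; rewrite Dy -rmorphD /= -subr_eq0 -rmorphB quot_proj_eq0.
  move=> /max_ideal_sqP[s [sm /(congr1 (meval (fun=> 0)))]].
  rewrite raddf_sum big_seq big1 => [|u /sm[u1 _]]; last first.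
    by rewrite /= mevalM max_ideal_meval0 // mul0r.
  rewrite mevalB mevalD mevalC (max_ideal_meval0 qm) addr0 => /eqP.
  by rewrite subr_eq0 => /eqP.
by congr (_, _) => //; apply: val_inj; rewrite /= Da rmorphB /= Dp addrC addKr.
Qed.

End FirstOrderRing.

Definition rota_baxter_weight1 (R : nzRingType) (P : R -> R) : Prop :=
  forall x y, P x * P y = P (x * P y + P x * y + x * y).

(* Main.v *)
Require Import Defs.
From HB Require Import structures.
From mathcomp Require Import all_boot all_order all_algebra.
From mathcomp Require Import mpoly.
From mathcomp Require Import ring.

(** Write [R = K (+) V] with [V * V = 0], and let [P] be Rota-Baxter.  Testing
    the identity on three kinds of pairs determines [P].

    - On [(u, u)] with [u] in [V]: if [P u] has scalar part [a], then the right
      hand side is [P (2 a u) = 2 a P u], with scalar part [2 a^2], while the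
      left hand side has scalar part [a^2].  Hence [a = 0] and [P] maps [V] to
      itself ([rota_baxter_cotangent]).
    - On [(1, u)]: with [P 1 = alpha + v], the terms [alpha P u] cancel and
      leave [P (P u) = - P u], so that [Q = - P] is idempotent on [V]
      ([rota_baxter_antiidempotent]).
    - On [(1, 1)]: the scalar part gives [alpha^2 + alpha = 0], and the part in
      [V] gives [2 P v + v = 0]; applying [P] to the latter and using
      [P (P v) = - P v] yields [P v = 0], hence [v = 0] ([rota_baxter_one]).

    Conversely, suppose [P 1 = alpha] with [alpha^2 + alpha = 0], that [P]
    preserves [V] and that [P (P u) = - P u] on [V].  Both sides of the identity
    at [(a + u, b + w)] then have scalar part [alpha^2 a b] and part
    [alpha (a P w + b P u)] in [V] ([antiidempotent_rota_baxter]).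

    Calculations take place inside the ring [R], with [V] as a subset and [P] in
    place of [- Q], so that ring identities apply; [rota_baxter_shape] and
    [shape_rota_baxter] translate to endomorphisms of the type [V]. *)

Import GRing.Theory.
Local Open Scope ring_scope.

Section Cotangent.
Variables (n : nat) (K : fieldType).
Local Notation R := (quot_ring n K).
Local Notation V := (cotangent_space n K).
Implicit Types (a b : K) (x y : R).

Lemma cotangentM x y :
  x \in @cotangent n K -> y \in @cotangent n K -> x * y = 0.
Proof.
move=> /cotangentP[p pm ->] /cotangentP[q qm ->].
apply/eqP; rewrite -rmorphM quot_proj_eq0; apply/max_ideal_sqP.
exists [:: (p, q)]; split; last by rewrite big_seq1.
by move=> u; rewrite inE => /eqP ->.
Qed.

Lemma quot_ring_split x :
  exists a, exists2 v, v \in @cotangent n K & x = a%:A + v.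
Proof.
have [[a u] [-> _]] := quot_ring_direct_sum x.
by exists a, (val u); first exact: valP.
Qed.

Lemma quot_ring_split_eq0 a x :
  x \in @cotangent n K -> a%:A + x = 0 -> a = 0 /\ x = 0.
Proof.
move=> Vx ax0; have [au [_ uniq_au]] := quot_ring_direct_sum (0 : R).
have /uniq_au E1 : 0 = (a, Sub x Vx : V).1%:A + val (a, Sub x Vx : V).2.
  by rewrite /= ax0.
have /uniq_au E2 : 0 = (0, 0 : V).1%:A + val (0 : K, 0 : V).2 :> R.
  by rewrite /= scale0r add0r.
have E : (a, Sub x Vx : V) = (0, 0) by rewrite -E1.
by split; [have := congr1 fst E | have := congr1 (fun au => val au.2) E].
Qed.

Lemma quot_ring_splitM a b x y : x \in @cotangent n K -> y \in @cotangent n K ->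
  (a%:A + x) * (b%:A + y) = (a * b)%:A + (a *: y + b *: x).
Proof.
move=> Vx Vy; rewrite mulrDl !mulrDr (cotangentM _ _ Vx Vy) addr0.
by rewrite !mulr_algl mulr_algr scalerA addrA.
Qed.

Section Necessity.
Variable P : {linear R -> R}.
Hypothesis RB_P : rota_baxter_weight1 P.

(** The pair [(x, x)] gives [a^2 = 2 a^2] for the scalar part [a] of [P x],
    because [x * P x] and [P x * x] both contribute [a *: x] under [P]. *)
Lemma rota_baxter_cotangent x : x \in @cotangent n K -> P x \in @cotangent n K.
Proof.
move=> Vx; have [a [v Vv Px]] := quot_ring_split (P x).
have := RB_P x x; rewrite (cotangentM _ _ Vx Vx) addr0 Px quot_ring_splitM //.
have -> : x * (a%:A + v) + (a%:A + v) * x = (a + a) *: x.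
  rewrite mulrDl mulrDr (cotangentM x v) // (cotangentM v x) // !addr0.
  by rewrite mulr_algl mulr_algr scalerDl.
(* Both sides have the same part [(a + a) *: v] in [V], which cancels. *)
rewrite linearZ /= Px scalerDr -scalerDl scalerA => /addIr /eqP.
rewrite -subr_eq0 -scalerBl => /eqP E.
have [|a20 _] := quot_ring_split_eq0 (a * a - (a + a) * a) 0 (rpred0 _).
  by rewrite addr0.
have /eqP : a * a = 0 by apply: oppr_inj; rewrite oppr0 -a20; ring.
by rewrite mulf_eq0 orbb => /eqP ->; rewrite scale0r add0r.
Qed.

(** In the identity at [(1, x)] the part of [P 1] in [V] is killed by [V * V = 0],
    and its scalar part contributes the same multiple of [P x] to both sides. *)
Lemma rota_baxter_antiidempotent x : x \in @cotangent n K -> P (P x) = - P x.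
Proof.
move=> Vx; have VPx := rota_baxter_cotangent x Vx.
have [a [v Vv P1]] := quot_ring_split (P 1).
have := RB_P 1 x; rewrite P1 !mul1r !mulrDl.
rewrite (cotangentM v x) // (cotangentM v (P x)) // !addr0 !mulr_algl.
rewrite !linearD linearZ /= addrAC -[LHS]add0r => /addIr /esym /eqP.
by rewrite addr_eq0 => /eqP.
Qed.

(** The identity at [(1, 1)] splits into [a^2 + a = 0] and [2 P v + v = 0].
    Applying [P] to the second turns [2 P (P v) + P v] into [- P v], so [P v] and
    then [v] vanish. *)
Lemma rota_baxter_one : exists2 a : K, a = 0 \/ a = -1 & P 1 = a%:A.
Proof.
have [a [v Vv P1]] := quot_ring_split (P 1).
have VPv := rota_baxter_cotangent v Vv.
have P1P1 : P (P 1) = a *: P 1 + P v by rewrite {1}P1 linearD linearZ.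
have := RB_P 1 1; rewrite !mul1r mulr1 !linearD P1P1 P1 quot_ring_splitM //.
rewrite !scalerDr !scalerA => /eqP; rewrite eq_sym -subr_eq0 => /eqP E.
have [||a0 v0] := quot_ring_split_eq0 (a * a + a) (P v + P v + v).
- by rewrite !rpredD.
- rewrite -E scalerDl.
  move: ((a * a)%:A) (a%:A) (a *: v) (P v) => A B C D; ring.
have Pv0 : P v = 0.
  have := congr1 P v0; rewrite !linearD linear0 rota_baxter_antiidempotent //.
  by rewrite addrNK => /eqP; rewrite oppr_eq0 => /eqP.
have {}v0 : v = 0 by rewrite -v0 Pv0 !add0r.
exists a; last by rewrite v0 addr0.
have /eqP : a * (a + 1) = 0 by rewrite mulrDr mulr1.
by rewrite mulf_eq0 addr_eq0 => /orP[] /eqP; [left|right].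
Qed.

Definition cotangent_opp_restr (u : V) : V :=
  Sub (- P (val u)) (rpredNr (rota_baxter_cotangent _ (valP u))).

Lemma cotangent_opp_restr_is_linear : linear cotangent_opp_restr.
Proof.
move=> a u w; apply: val_inj.
by rewrite /= linearP opprD scalerN.
Qed.

HB.instance Definition _ := GRing.isLinear.Build K V V *:%R
  cotangent_opp_restr cotangent_opp_restr_is_linear.

Lemma rota_baxter_shape :
  exists (alpha : K) (Q : {linear V -> V}),
    [/\ alpha = 0 \/ alpha = -1,
        forall u, Q (Q u) = Q u
      & forall (a : K) (u : V),
          P (a%:A + val u) = (alpha * a)%:A - val (Q u)].
Proof.
have [alpha alphaP P1] := rota_baxter_one.
exists alpha, cotangent_opp_restr; split=> // [u | a u].
  apply: val_inj; rewrite /= linearN opprK.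
  exact: rota_baxter_antiidempotent (valP u).
by rewrite /= opprK linearD linearZ /= P1 scalerA mulrC.
Qed.

End Necessity.

(** After expansion by linearity, only multiples of [1], [P u] and [P w] remain;
    their coefficients agree because [alpha] is [0] or [-1]. *)
Lemma antiidempotent_rota_baxter (P : {linear R -> R}) (alpha : K) :
    alpha = 0 \/ alpha = -1 -> P 1 = alpha%:A ->
    (forall x, x \in @cotangent n K -> P x \in @cotangent n K) ->
    (forall x, x \in @cotangent n K -> P (P x) = - P x) ->
  rota_baxter_weight1 P.
Proof.
move=> alphaP P1 PV PP x y.
have Psplit b z : P (b%:A + z) = (alpha * b)%:A + P z.
  by rewrite linearD linearZ /= P1 scalerA mulrC.
have [a [u Vu ->]] := quot_ring_split x.
have [b [w Vw ->]] := quot_ring_split y.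
have [VPu VPw] := (PV u Vu, PV w Vw).
rewrite !Psplit !quot_ring_splitM // !linearD !linearZ /= P1 !PP //.
case: alphaP => ->.
  rewrite !(mul0r, mulr0, scale0r, scaler0, add0r) !scalerN.
  move: (a *: P w) (b *: P u) => aq bp; ring.
rewrite !(scalerA, mulrN1, mulN1r, mulrNN, mulNr, mulrN, opprK, scalerN, scaleNr).
move: ((a * b)%:A) (a *: P w) (b *: P u) => ab aq bp; ring.
Qed.

Lemma shape_rota_baxter (P : {linear R -> R}) (alpha : K)
    (Q : {linear V -> V}) :
    alpha = 0 \/ alpha = -1 -> (forall u, Q (Q u) = Q u) ->
    (forall (a : K) (u : V),
       P (a%:A + val u) = (alpha * a)%:A - val (Q u)) ->
  rota_baxter_weight1 P.
Proof.
move=> alphaP QQ PE.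
have P1 : P 1 = alpha%:A.
  have := PE 1 0; rewrite (linear0 Q) linear0.
  by rewrite subr0 addr0 mulr1 scale1r.
have PV (t : V) : P (val t) = - val (Q t).
  by have := PE 0 t; rewrite mulr0 scale0r !add0r.
apply: antiidempotent_rota_baxter alphaP P1 _ _ => x Vx.
  by rewrite (PV (Sub x Vx)) rpredN; apply: valP.
by rewrite (PV (Sub x Vx)) linearN /= PV QQ.
Qed.

End Cotangent.

Theorem theorem4p3 (K : fieldType) (charK : [pchar K] =i pred0)
    (n : nat) (hn : (1 <= n)%N)
    (P : {linear quot_ring n K -> quot_ring n K}) :
  rota_baxter_weight1 P <->
  exists (alpha : K) (Q : {linear cotangent_space n K -> cotangent_space n K}),
    [/\ alpha = 0 \/ alpha = -1,
        forall u, Q (Q u) = Q u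
      & forall (a : K) (u : cotangent_space n K),
          P (a%:A + val u) = (alpha * a)%:A - val (Q u)].
Proof.
split=> [|[alpha [Q [alphaP QQ PE]]]]; first exact: rota_baxter_shape.
exact: shape_rota_baxter alphaP QQ PE.
Qed.
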